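(* Let $a,b,n$ be non-negative integers and let $p$ be a prime. Suppose that at least one of the following holds: (i) $p$ divides none of the integers $a$, $b$, $a-b$, $n$, $a^2-nb-a+b$; (ii) $p\mid a$, $p\nmid b$ and $p\nmid n-1$. Then for any $(a,b)$-town$\pmod p$ family $\mathcal{F}\subseteq\mathscr{P}(n)$ we have $|\mathcal{F}|\leq n-1$.
   Context: $[n]=\{1,2,\ldots,n\}$ for a positive integer $n$, with the convention $[0]=\emptyset$, and $\mathscr{P}(n)$ is the power set of $[n]$; a family $\mathcal{F}\subseteq\mathscr{P}(n)$ is a set of (distinct) subsets of $[n]$. For integers $k\ge 2$ and $a,b$ (only their residues modulo $k$ matter), a family $\mathcal{F}\subseteq\mathscr{P}(n)$ is an $(a,b)$-town$\pmod k$ if for any distinct $A,B\in\mathcal{F}$ we have $|A|\equiv a\pmod k$ and $|A\cap B|\equiv b\pmod k$; that is, every set in $\mathcal{F}$ has cardinality $\equiv a\pmod k$ and every intersection of two distinct sets of $\mathcal{F}$ has cardinality $\equiv b\pmod k$.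
   Formalization: The formal theorem assumes n ≥ 1: for n = 0 condition (ii) can hold (e.g. p = 2, a = 0, b = 1), and then the empty family violates the bound |F| ≤ −1; condition (i) already excludes n = 0. *)

(* Defs.v *)
From mathcomp Require Import all_boot all_order all_algebra.

Set Implicit Arguments.
Unset Strict Implicit.
Unset Printing Implicit Defensive.

Import Order.TTheory GRing.Theory Num.Theory.
Local Open Scope ring_scope.

(* The ground set [n] = {1, ..., n} is represented by 'I_n = {0, ..., n-1}.
   The cardinality condition is imposed on every member of F, also when F has
   a single member and hence no pair of distinct members. *)
Definition town (k : nat) (a b : int) (n : nat) (F : {set {set 'I_n}}) : Prop :=
  (forall A, A \in F -> (#|A|%:Z = a %[mod k%:Z])%Z) /\
  (forall A B, A \in F -> B \in F -> A != B ->
     (#|A :&: B|%:Z = b %[mod k%:Z])%Z).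

(* Main.v *)
Require Import Defs.
From mathcomp Require Import all_boot all_order all_algebra.
From mathcomp Require Import ring zify.

(** If [#|F| >= n], choose [n] members of [F] and let [M] be the square matrix
over ['F_p] of their incidence vectors, so that [M M^T = (a - b) I + b J] and
[M 1 = a 1].  In case (i) the rows of [M] together with the all-one vector are
[n + 1] vectors in dimension [n], hence dependent; pairing a dependency with
each of these vectors forces it to vanish, because the sum [S] of its
coefficients on the rows of [M] satisfies [(a^2 - n b - a + b) S = 0].  In case
(ii) [M 1 = 0], so [M] is singular, whereas [M M^T = b (J - I)] is invertible
since [n <> 1] in ['F_p]. *)

Set Implicit Arguments.
Unset Strict Implicit.
Unset Printing Implicit Defensive.

Import Order.TTheory GRing.Theory Num.Theory.
Local Open Scope ring_scope.

Section GramMatrix.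

Variables (K : fieldType) (n : nat) (a b : K) (M : 'M[K]_n).
Hypothesis M_gram :
  forall i j, \sum_k M i k * M j k = if i == j then a else b.
Hypothesis M_row_sum : forall i, \sum_k M i k = a.

(** Pair the relation with row [j]: the all-one vector contributes [c * a], row [j] itself
    [a * x j], and every other row [b * x i]. Taking [c = 0] covers dependencies among the rows
    alone. *)
Lemma relation_dot_row (c : K) (x : 'I_n -> K) :
  (forall k, c + \sum_i x i * M i k = 0) ->
  forall j, c * a + (a - b) * x j + b * \sum_i x i = 0.
Proof.
move=> rel j.
have: \sum_k (c + \sum_i x i * M i k) * M j k = 0.
  by rewrite big1 // => k _; rewrite rel mul0r.
under eq_bigr do rewrite mulrDl mulr_suml.
rewrite big_split /= -mulr_sumr M_row_sum exchange_big /=.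
under [X in _ + X]eq_bigr => i _.
  under eq_bigr do rewrite -mulrA.
  rewrite -mulr_sumr M_gram.
  over.
rewrite [X in _ + X](bigD1 j) //= eqxx.
under [X in _ + (_ + X)]eq_bigr => i /negPf ne do rewrite ne.
rewrite -mulr_suml => sum0.
by rewrite -[RHS]sum0 [\sum_i x i](bigD1 j) //=; ring.
Qed.

Lemma relation_dot_ones (c : K) (x : 'I_n -> K) :
  (forall k, c + \sum_i x i * M i k = 0) -> c * n%:R + a * \sum_i x i = 0.
Proof.
move=> rel.
have: \sum_k (c + \sum_i x i * M i k) = 0 by rewrite big1.
rewrite big_split /= sumr_const card_ord exchange_big /= mulr_natr.
under [X in _ + X]eq_bigr do rewrite -mulr_sumr M_row_sum.
by rewrite -mulr_suml [_ * a]mulrC.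
Qed.

Lemma gram_bordered_degenerate :
  a - b != 0 -> n%:R != 0 :> K -> a ^+ 2 - n%:R * b - a + b = 0.
Proof.
move=> ab_neq0 n_neq0; apply/eqP/negPn/negP => disc_neq0.
pose N := col_mx (const_mx 1 : 'rV_n) M.
(* [N] has [n + 1] rows but only [n] columns, so its left kernel is nonzero. *)
have /rowV0Pn[v /sub_kermxP vN v_neq0] : kermx N != 0.
  rewrite -mxrank_eq0 mxrank_ker -lt0n subn_gt0.
  exact: leq_ltn_trans (rank_leq_col N) _.
pose c := v 0 (lshift n 0); pose x i := v 0 (rshift 1 i).
have rel k : c + \sum_i x i * M i k = 0.
  move/rowP/(_ k): vN; rewrite !mxE big_split_ord big_ord1 /= col_mxEu mxE mulr1.
  by under eq_bigr do rewrite col_mxEd.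
have dot_row := relation_dot_row rel; have dot_ones := relation_dot_ones rel.
set S := \sum_i x i in dot_row dot_ones.
have S0 : S = 0.
  have: \sum_j (c * a + (a - b) * x j + b * S) = 0 by rewrite big1.
  rewrite !big_split /= !sumr_const card_ord -mulr_sumr -/S.
  rewrite -[c * a *+ n]mulr_natr -[b * S *+ n]mulr_natr => sum0.
  apply: (mulfI disc_neq0); rewrite mulr0.
  (* This combination eliminates [c]: [a] times the pairing with the all-one vector, minus the sum
     of the pairings with all rows. *)
  transitivity (a * (c * n%:R + a * S)
                - (c * a * n%:R + (a - b) * S + b * S * n%:R)); first ring.
  by rewrite dot_ones sum0 mulr0 subr0.
have c0 : c = 0.
  by apply: (mulIf n_neq0); rewrite mul0r -dot_ones S0 mulr0 addr0.
have x0 j : x j = 0.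
  by apply: (mulfI ab_neq0); rewrite mulr0 -[RHS](dot_row j) c0 S0; ring.
case/negP: v_neq0; apply/eqP/rowP => k; rewrite mxE.
by case: (split_ordP k) => i ->; [rewrite [i]ord1; exact: c0 | exact: x0].
Qed.

Lemma gram_isotropic_degenerate :
  (0 < n)%N -> a = 0 -> b != 0 -> n%:R = 1 :> K.
Proof.
move=> n_gt0 a0 b_neq0; apply/eqP; rewrite -subr_eq0.
apply/negPn/negP => n1_neq0.
(* The all-one column lies in the kernel of [M] and is nonzero because [0 < n]; the vanishing
   determinant converts it into a dependency [v] between the rows. *)
have /det0P[v v_neq0 vM] : \det M == 0.
  rewrite -det_tr; apply/det0P; exists (const_mx 1).
    by apply/rV0Pn; exists (Ordinal n_gt0); rewrite mxE oner_neq0.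
  apply/rowP => i; rewrite !mxE -[RHS]a0 -(M_row_sum i).
  by apply: eq_bigr => k _; rewrite !mxE mul1r.
have rel k : 0 + \sum_i v 0 i * M i k = 0.
  by move/rowP/(_ k): vM; rewrite !mxE add0r.
have dot_row := relation_dot_row rel.
set S := \sum_i v 0 i in dot_row.
(* With [a = 0] and no all-one term, pairing with row [j] gives [b * (S - v 0 j) = 0]. *)
have vS j : v 0 j = S.
  apply: (mulfI b_neq0); apply/esym/subr0_eq.
  by rewrite -[RHS](dot_row j) a0; ring.
(* Summing the [n] equal entries of [v] gives [n * S = S]. *)
have S0 : S = 0.
  apply: (mulfI n1_neq0); rewrite mulr0 mulrBl mul1r {2}/S.
  by under eq_bigr do rewrite vS; rewrite sumr_const card_ord mulr_natl subrr.
by case/negP: v_neq0; apply/eqP/rowP => k; rewrite mxE vS.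
Qed.

End GramMatrix.

Lemma intr_Fp_eq0 (p : nat) (x : int) :
  prime p -> (x%:~R == 0 :> 'F_p) = (p%:Z %| x)%Z.
Proof. by move=> p_prime; rewrite (dvdz_pcharf (pchar_Fp p_prime)). Qed.

Lemma incidence_dot (R : nzRingType) (T : finType) (A B : {set T}) :
  \sum_k (k \in A)%:R * (k \in B)%:R = #|A :&: B|%:R :> R.
Proof.
rewrite -sum1_card natr_sum [RHS]big_mkcond /=.
by apply: eq_bigr => k _; rewrite inE -natrM mulnb; case: ifP.
Qed.

(* n = 0 is excluded: there alternative (ii) can hold (p does not divide -1),
   and the bound would read #|F| <= -1. *)
Theorem proposition2p2 (a b n p : nat) (n_gt0 : (0 < n)%N) (p_prime : prime p)
  (hyp :
     [/\ ~ (p%:Z %| a%:Z)%Z, ~ (p%:Z %| b%:Z)%Z, ~ (p%:Z %| a%:Z - b%:Z)%Z,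
         ~ (p%:Z %| n%:Z)%Z
       & ~ (p%:Z %| a%:Z ^+ 2 - n%:Z * b%:Z - a%:Z + b%:Z)%Z]
     \/
     [/\ (p%:Z %| a%:Z)%Z, ~ (p%:Z %| b%:Z)%Z & ~ (p%:Z %| n%:Z - 1)%Z])
  (F : {set {set 'I_n}}) (F_town : town p a%:Z b%:Z F) :
  #|F|%:Z <= n%:Z - 1.
Proof.
suff: (#|F| < n)%N by lia.
rewrite ltnNge; apply/negP => le_nF.
have modE (x y : nat) : (x%:Z = y%:Z %[mod p%:Z])%Z -> x%:R = y%:R :> 'F_p.
  move/eqP; rewrite eqz_mod_dvd -intr_Fp_eq0 // rmorphB subr_eq0.
  by move/eqP.
case: F_town => F_size F_inter.
pose A (i : 'I_n) : {set 'I_n} := enum_val (widen_ord le_nF i).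
have A_F i : A i \in F by exact: enum_valP.
have A_inj : injective A.
  by move=> i j /enum_val_inj /(congr1 val) /= /val_inj.
pose M : 'M['F_p]_n := \matrix_(i, k) (k \in A i)%:R.
have M_gram i j : \sum_k M i k * M j k = if i == j then a%:R else b%:R.
  under eq_bigr do rewrite !mxE.
  rewrite incidence_dot; case: eqP => [<-|/eqP ne_ij].
    by rewrite setIid; exact/modE/F_size.
  by apply/modE/F_inter; rewrite ?inj_eq.
have M_row_sum i : \sum_k M i k = a%:R.
  (* Entries 0 and 1 are idempotent, so a row sum is the pairing of the row with itself. *)
  rewrite -(modE _ _ (F_size _ (A_F i))) -[A i]setIid -incidence_dot.
  by apply: eq_bigr => k _; rewrite mxE -natrM mulnb andbb.
case: hyp => [[_ _ ab_ndvd n_ndvd disc_ndvd]|[a_dvd b_ndvd n1_ndvd]].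
- case: disc_ndvd; rewrite -intr_Fp_eq0 //.
  rewrite !(rmorphD, rmorphN, rmorphM, rmorphXn) /=.
  apply/eqP; apply: (gram_bordered_degenerate M_gram M_row_sum).
    by apply/negP => ab0; apply: ab_ndvd; rewrite -intr_Fp_eq0 // rmorphB.
  by apply/negP => n0; apply: n_ndvd; rewrite -intr_Fp_eq0.
- case: n1_ndvd; rewrite -intr_Fp_eq0 // rmorphB subr_eq0; apply/eqP.
  apply: (gram_isotropic_degenerate M_gram M_row_sum n_gt0).
    by apply/eqP; rewrite -intr_Fp_eq0 // in a_dvd.
  by apply/negP => b0; apply: b_ndvd; rewrite -intr_Fp_eq0.
Qed.
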